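(* Let $m\ge 2$, let $\mathcal{H}_0$ be an $m$-uniform hypergraph on the vertex set $V_0=\{1,\dots,n\}$, and let $\mathcal{H}_1,\dots,\mathcal{H}_n$ be $r_1$-regular $m$-uniform hypergraphs, each with $n_1$ vertices. Let $\mu_1,\dots,\mu_n$ be the eigenvalues (with multiplicity) of $A_{\mathcal{H}_0}$ and, for each $i=1,\dots,n$, let $\lambda^{(i)}_1,\lambda^{(i)}_2,\dots,\lambda^{(i)}_{n_1}(=r_1)$ be the eigenvalues (with multiplicity) of $A_{\mathcal{H}_i}$. Put $$b=\frac{1}{m-1}\binom{n_1-1}{m-2},\qquad c=\frac{1}{m-1}\left[\binom{n_1-1}{m-2}-\binom{n_1-2}{m-2}\right].$$ Let $\mathcal{H}_\pi=\mathcal{H}_0\circ^n_1\mathcal{H}_i$. Then the eigenvalues of $A_{\mathcal{H}_\pi}$, listed with multiplicity, are $\lambda^{(i)}_j-c$ with multiplicity one for $i=1,\dots,n$, $j=1,\dots,n_1-1$, together with $\alpha_i^{+}$ and $\alpha_i^{-}$ with multiplicity one for $i=1,\dots,n$, where $$\alpha_i^{\pm}=\frac12\Big[r_1+(n_1-1)c+\mu_i\pm\sqrt{\{r_1+(n_1-1)c-\mu_i\}^2+4b^2n_1}\Big].$$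
   Context: All hypergraphs are finite and unweighted. The adjacency matrix $A_{\mathcal{H}}$ of an $m$-uniform hypergraph $\mathcal{H}$ has zero diagonal and, for $i\ne j$, $(i,j)$ entry equal to $\frac1{m-1}$ times the number of edges containing both $i$ and $j$. A hypergraph is $r$-regular if every vertex lies in exactly $r$ edges. The eigenvalue $\lambda^{(i)}_{n_1}=r_1$ is the one with the all-ones eigenvector; the remaining list $\lambda^{(i)}_1,\dots,\lambda^{(i)}_{n_1-1}$ is obtained by removing one copy of $r_1$ from the spectrum. The corona $\mathcal{H}_\pi=\mathcal{H}_0\circ^n_1\mathcal{H}_i$ (generalized corona for the partition of $V_0$ into singletons, with one copy of each $\mathcal{H}_i$) is the $m$-uniform hypergraph on the disjoint union $V_0\cup V(\mathcal{H}_1)\cup\dots\cup V(\mathcal{H}_n)$ whose edges are: all edges of $\mathcal{H}_0$; all edges of each $\mathcal{H}_i$; and, for each $i=1,\dots,n$, every $m$-subset of $\{i\}\cup V(\mathcal{H}_i)$ that contains $i$ and meets $V(\mathcal{H}_i)$. Binomial coefficients $\binom{N}{l}$ are $0$ when $N<0$ or $l>N$ (the value of $c$ is immaterial when $n_1=1$). *)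

(* Defs.v *)
From mathcomp Require Import all_boot all_order all_algebra.

Set Implicit Arguments.
Unset Strict Implicit.
Unset Printing Implicit Defensive.

Import Order.TTheory GRing.Theory Num.Theory.
Local Open Scope ring_scope.

Definition hypergraph (T : finType) := {set {set T}}.

Definition uniform (m : nat) (T : finType) (H : hypergraph T) : Prop :=
  forall e : {set T}, e \in H -> #|e| = m.

Definition regular (r : nat) (T : finType) (H : hypergraph T) : Prop :=
  forall x : T, #|[set e in H | x \in e]| = r.

(* Rows and columns are indexed by the enumeration of the vertex type. *)
Definition adjacency (R : fieldType) (m : nat) (T : finType)
    (H : hypergraph T) : 'M[R]_#|T| :=
  \matrix_(i, j)
    if i == j then 0
    else #|[set e in H | (enum_val i \in e) && (enum_val j \in e)]|%:R
         / m.-1%:R.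

(* s lists the eigenvalues of A with (algebraic) multiplicity, in any order;
   in particular A has all its eigenvalues in R. *)
Definition is_spectrum (R : fieldType) (N : nat) (A : 'M[R]_N) (s : seq R) :
    Prop :=
  char_poly A = \prod_(x <- s) ('X - x%:P).

Section Corona.

Variables (n : nat) (V : 'I_n -> finType).

(* Disjoint union of {1, ..., n} and of all the V i. *)
Definition corona_vertex : finType := ('I_n + {i : 'I_n & V i})%type.

Definition base (i : 'I_n) : corona_vertex := inl i.

Definition copy (i : 'I_n) (v : V i) : corona_vertex := inr (Tagged V v).

Definition join_edges (m : nat) (i : 'I_n) : hypergraph corona_vertex :=
  [set e : {set corona_vertex} |
    [&& #|e| == m,
        e \subset base i |: [set copy v | v : V i],
        base i \in e
      & [exists v : V i, copy v \in e]]].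

Definition corona (m : nat) (H0 : hypergraph 'I_n)
    (H : forall i : 'I_n, hypergraph (V i)) : hypergraph corona_vertex :=
  [set base @: e | e : {set 'I_n} in H0]
  :|: \bigcup_(i < n) [set [set copy v | v in e] | e : {set V i} in H i]
  :|: \bigcup_(i < n) join_edges m i.

End Corona.

(* Binomial coefficient with integer upper index, 0 when that is negative. *)
Definition binz (N : int) (l : nat) : nat :=
  if N is Posz p then 'C(p, l) else 0%N.

Definition corona_b (R : fieldType) (m n1 : nat) : R :=
  (binz (n1%:Z - 1) (m - 2))%:R / m.-1%:R.

Definition corona_c (R : fieldType) (m n1 : nat) : R :=
  ((binz (n1%:Z - 1) (m - 2))%:R - (binz (n1%:Z - 2) (m - 2))%:R) / m.-1%:R.

(* The eigenvalue with sign + for s = false and sign - for s = true. *)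
Definition corona_alpha (R : rcfType) (m n1 r1 : nat) (mu : R) (s : bool) : R :=
  let b := corona_b R m n1 in
  let t := r1%:R + (n1%:R - 1) * corona_c R m n1 in
  (t + mu + (-1) ^+ s * Num.sqrt ((t - mu) ^+ 2 + 4 * b ^+ 2 * n1%:R)) / 2.

(* Main.v *)
Require Import Defs.
From mathcomp Require Import all_boot all_order all_algebra.
From mathcomp Require Import perm ring zify.

(** The characteristic polynomial of the corona is evaluated at an [x] that
    avoids two values; two polynomials that agree at all such [x] are equal
    ([poly_eq_outside]).

    Write [t = r1 + (n1 - 1) c]. Counting edges through pairs of vertices
    shows that the adjacency matrix of the corona has the following blocks:
    [A_0] on the base; [b] between a base vertex and each vertex of its own
    copy, [0] between it and the other copies; [A_i + c (J - I)] on the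
    [i]-th copy, with [J] the all-ones matrix, and [0] between two different
    copies ([weight_base], [weight_base_copy], [weight_copy],
    [weight_copies]).

    By regularity, each row of [A_i] sums to [r1] ([sum_weight]), hence the
    rows of [x - A_i - c (J - I)] sum to [x - t]. So, with [D]
    the block of all copies, [x - D] maps the indicator of each copy to
    [x - t] times itself, and the Schur complement of [x - D]
    ([fdet_sum_schur]) is just [x - b ^+ 2 n1 / (x - t) - A_0]. Its
    determinant is the characteristic polynomial of [A_0] at a shifted point,
    namely the product of the [x - b ^+ 2 n1 / (x - t) - mu i].

    The matrix [x - D] is itself block diagonal ([fdet_tagged]), and on the
    [i]-th copy it is [(x + c) - A_i - c J], a rank-one perturbation along
    the all-ones eigenvector. By [fdet_sub_const] its determinant is that of
    [(x + c) - A_i] with the factor [x + c - r1] replaced by [x - t]. This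
    leaves the eigenvalues [lambda i j - c] and one factor [x - t] per copy;
    the latter clears the denominator in
    [x - b ^+ 2 n1 / (x - t) - mu i] and yields the quadratic whose roots are
    the two values of [corona_alpha] ([corona_alphaP]). *)

Set Implicit Arguments.
Unset Strict Implicit.
Unset Printing Implicit Defensive.

Import Order.TTheory GRing.Theory Num.Theory.
Local Open Scope ring_scope.

(** * Polynomials and determinants *)

(** The exceptions in [s] let the values of the polynomials be computed by
    rational expressions, away from their poles. *)
Lemma poly_eq_outside (R : numDomainType) (s : seq R) (p q : {poly R}) :
  (forall x, x \notin s -> p.[x] = q.[x]) -> p = q.
Proof.
move=> pq; pose w := \prod_(a <- s) ('X - a%:P).
have w0 : w != 0 by rewrite monic_neq0 ?monic_prod_XsubC.
apply/eqP; rewrite -subr_eq0 -[_ == 0]orbF -(negPf w0) -mulf_eq0.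
pose rs : seq R := [seq k%:R | k <- iota 0 (size ((p - q) * w))].
apply: contraTT (leqnn (size rs)) => pqw0.
rewrite -ltnNge {2}size_map size_iota; apply: max_poly_roots => //.
  apply/allP => x _; rewrite /root hornerM.
  have [xs|/pq xpq] := boolP (x \in s); last first.
    by rewrite hornerD hornerN xpq subrr mul0r.
  by move: xs; rewrite -root_prod_XsubC => /eqP ->; rewrite mulr0.
rewrite map_inj_uniq ?iota_uniq // => i j /eqP.
by rewrite eqr_nat => /eqP.
Qed.

Lemma horner_char_poly (R : comNzRingType) (n : nat) (A : 'M[R]_n) (x : R) :
  (char_poly A).[x] = \det (x%:M - A).
Proof.
rewrite -[LHS]/(horner_eval x _) /char_poly -det_map_mx; congr (\det _).
apply/matrixP => i j; rewrite !mxE /= /horner_eval.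
by rewrite hornerD hornerN hornerMn hornerX hornerC.
Qed.

(** A Schur complement without inverting [D]: right multiplication by the
    unipotent matrix with lower left block [- U] clears [S]. *)
Lemma det_block_schur (R : comNzRingType) (k l : nat) (P : 'M[R]_k)
    (Q : 'M[R]_(k, l)) (S : 'M[R]_(l, k)) (D : 'M[R]_l) (U : 'M[R]_(l, k)) :
  D *m U = S -> \det (block_mx P Q S D) = \det (P - Q *m U) * \det D.
Proof.
move=> DU; rewrite -(det_ublock _ Q) -[LHS]mulr1.
have <- : \det (block_mx 1%:M 0 (- U) 1%:M : 'M[R]_(k + l)) = 1.
  by rewrite det_lblock !det1 mulr1.
rewrite -det_mulmx mulmx_block !mulmx1 !mulmx0 !add0r !mulmxN DU subrr.
by [].
Qed.

(** Both sides are the determinant of the block matrix with diagonal blocks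
    [1], [1] and off-diagonal blocks [v], [u], eliminated in its two ways. *)
Lemma det_sub_rank1 (R : comNzRingType) (n : nat) (u : 'cV[R]_n)
    (v : 'rV[R]_n) : \det (1%:M - u *m v) = 1 - (v *m u) 0 0.
Proof.
have detE : \det (block_mx 1%:M (- v) 0 1%:M : 'M[R]_(1 + n)) = 1.
  by rewrite det_ublock !det1 mulr1.
have := @det_block_schur _ 1 n 1%:M v u 1%:M u (mul1mx u).
rewrite det1 mulr1 [in RHS]det_mx11 !mxE => <-.
rewrite -[RHS]mulr1 -[X in _ * X]detE -det_mulmx mulmx_block !mul1mx !mulmx1.
by rewrite !mulmx0 !addr0 addNr mulmxN addrC det_lblock det1 mul1r.
Qed.

(** Since [M] times the all-ones matrix [J] is [s J], the matrix [M - c J]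
    factors as [M (1 - (c / s) J)], a rank-one update of [M]. *)
Lemma det_sub_const (F : fieldType) (n : nat) (M : 'M[F]_n) (s c : F) :
  s != 0 -> (forall i, \sum_j M i j = s) ->
  \det (M - const_mx c) = \det M * ((s - n%:R * c) / s).
Proof.
move=> s0 rowM.
have -> : M - const_mx c = M *m
    (1%:M - (const_mx (c / s) : 'cV_n) *m (const_mx 1 : 'rV_n)).
  rewrite mulmxBr mulmx1 mulmxA; congr (_ - _); apply/matrixP => i j.
  rewrite !mxE big_ord1 !mxE mulr1.
  by under eq_bigr do rewrite mxE; rewrite -mulr_suml rowM mulrC divfK.
rewrite det_mulmx det_sub_rank1; congr (_ * _).
rewrite !mxE; under eq_bigr do rewrite !mxE mul1r.
by rewrite sumr_const card_ord -mulr_natl; field.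
Qed.

Lemma det_castmx (R : comNzRingType) (k l : nat) (e : k = l) (A : 'M[R]_k) :
  \det (castmx (e, e) A) = \det A.
Proof. by case: _ / e; rewrite castmx_id. Qed.

Lemma det_mxdiag (R : comNzRingType) (n : nat) (p : 'I_n -> nat)
    (B : forall i, 'M[R]_(p i)) :
  \det (\mxdiag_i B i) = \prod_i \det (B i).
Proof.
elim: n => [|n IHn] in p B *.
  have det_empty k (A : 'M[R]_k) : k = 0%N -> \det A = 1.
    by move=> k0; case: _ / (esym k0) in A *; rewrite det_mx00.
  by rewrite det_empty !big_ord0.
by rewrite mxdiag_recl det_castmx det_ublock IHn big_ord_recl.
Qed.

(** * Determinants of kernels on finite types *)

Definition mxfun (R : Type) (S T : finType) (f : S -> T -> R) :
    'M[R]_(#|S|, #|T|) :=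
  \matrix_(i, j) f (enum_val i) (enum_val j).

(** A determinant attached to a function of two vertices, so that vertex sets
    built as sums can be split without tracking their enumerations. *)
Definition fdet (R : comNzRingType) (T : finType) (f : T -> T -> R) : R :=
  \det (mxfun f).

(** Any two enumerations of [T] differ by a permutation, which is applied to
    the rows and to the columns; its sign is squared. *)
Lemma det_reindex (R : comNzRingType) (T : finType) (f : T -> T -> R)
    (N : nat) (g : 'I_N -> T) :
  bijective g -> \det (\matrix_(i, j) f (g i) (g j)) = fdet f.
Proof.
move=> bg; have eN : N = #|T| by rewrite -(bij_eq_card bg) card_ord.
subst N; pose h i := enum_rank (g i).
have hI : injective h by move=> i j /enum_rank_inj /(bij_inj bg).
pose s := perm hI.
have -> : \matrix_(i, j) f (g i) (g j) = row_perm s (col_perm s (mxfun f)).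
  by apply/matrixP => i j; rewrite !mxE !permE /h !enum_rankK.
rewrite row_permE col_permE !det_mulmx !det_perm mulrCA.
by rewrite odd_permV -signr_addb addbb mulr1.
Qed.

Lemma eq_fdet (R : comNzRingType) (T : finType) (f g : T -> T -> R) :
  f =2 g -> fdet f = fdet g.
Proof.
by move=> fg; congr (\det _); apply/matrixP => i j; rewrite !mxE fg.
Qed.

Lemma sum_enum_val (R : nmodType) (T : finType) (F : T -> R) :
  \sum_(i < #|T|) F (enum_val i) = \sum_x F x.
Proof. by rewrite [RHS](reindex _ (onW_bij _ (@enum_val_bij T))). Qed.

(** [u] solves, column by column, the linear system that expresses the lower
    left block through the lower right one. *)
Lemma fdet_sum_schur (R : comNzRingType) (S T : finType)
    (f : S + T -> S + T -> R) (u : T -> S -> R) :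
  (forall t s, \sum_t' f (inr t) (inr t') * u t' s = f (inr t) (inl s)) ->
  fdet f = fdet (fun s s' => f (inl s) (inl s')
                             - \sum_t f (inl s) (inr t) * u t s')
           * fdet (fun t t' => f (inr t) (inr t')).
Proof.
move=> fu; pose g (k : 'I_(#|S| + #|T|)) : (S + T)%type :=
  match split k with inl i => inl (enum_val i) | inr j => inr (enum_val j) end.
have gK : bijective g.
  apply: inj_card_bij => [k l|]; last by rewrite card_sum card_ord.
  rewrite /g -{2}(splitK k) -{2}(splitK l).
  by case: (split k) => a; case: (split l) => b // [] /enum_val_inj ->.
rewrite -(det_reindex f gK).
have -> : \matrix_(i, j) f (g i) (g j) =
    block_mx (mxfun (fun s s' => f (inl s) (inl s')))
             (mxfun (fun s t => f (inl s) (inr t)))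
             (mxfun (fun t s => f (inr t) (inl s)))
             (mxfun (fun t t' => f (inr t) (inr t'))).
  apply/matrixP => i j; rewrite !mxE /g.
  by case: (split i) => a; rewrite !mxE; case: (split j) => b; rewrite !mxE.
rewrite (@det_block_schur _ _ _ _ _ _ _ (mxfun u)).
  congr (\det _ * _); apply/matrixP => i j; rewrite !mxE.
  congr (_ - _); rewrite -[RHS]sum_enum_val.
  by apply: eq_bigr => k _; rewrite !mxE.
apply/matrixP => i j; rewrite !mxE -fu -[RHS]sum_enum_val.
by apply: eq_bigr => k _; rewrite !mxE.
Qed.

Lemma fdet_tagged (R : comNzRingType) (n : nat) (V : 'I_n -> finType)
    (f : {i : 'I_n & V i} -> {i : 'I_n & V i} -> R) :
  (forall p q, tag p != tag q -> f p q = 0) ->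
  fdet f = \prod_(i < n) fdet (fun u v : V i => f (Tagged V u) (Tagged V v)).
Proof.
move=> f0; pose g (k : 'I_(\sum_i #|V i|)) :=
  Tagged V (enum_val (tagged (tagnat.sig k))).
have gK : bijective g.
  apply: inj_card_bij => [k l|]; last first.
    rewrite card_ord card_tagged sumnE big_map big_enum; exact: leqnn.
  rewrite /g => e; apply: tagnat.sig_inj; move: e.
  case: (tagnat.sig k) => i a; case: (tagnat.sig l) => j b /=.
  move=> e; have ij : i = j := congr1 tag e.
  by subst j; congr Tagged; apply: enum_val_inj; apply: eq_from_Tagged e.
rewrite -(det_reindex f gK) -det_mxdiag; congr (\det _).
apply/matrixP => k l; rewrite !mxE /g /tagnat.sig1 /tagnat.sig2.
case: (tagnat.sig k) => i a; case: (tagnat.sig l) => j b /=.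
case: eqVneq => [e|ij]; last by rewrite mxE f0.
by case: _ / e in b *; rewrite conform_mx_id mxE.
Qed.

Lemma fdet_sub_const (F : fieldType) (T : finType) (f : T -> T -> F) (s c : F) :
  s != 0 -> (forall u, \sum_v f u v = s) ->
  fdet (fun u v => f u v - c) = fdet f * ((s - #|T|%:R * c) / s).
Proof.
move=> s0 fs; rewrite -det_sub_const //.
  by congr (\det _); apply/matrixP => i j; rewrite !mxE.
by move=> i; under eq_bigr do rewrite mxE; rewrite sum_enum_val fs.
Qed.

Lemma sum_tagged (R : nmodType) (n : nat) (V : 'I_n -> finType)
    (F : {i : 'I_n & V i} -> R) (i : 'I_n) :
  (forall q, tag q != i -> F q = 0) ->
  \sum_q F q = \sum_(v : V i) F (Tagged V v).
Proof.
move=> F0; transitivity (\sum_(k < n) \sum_(v : V k) F (Tagged V v)).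
  by rewrite sig_big_dep /=; apply: eq_bigr => -[].
by rewrite (bigD1 i) //= [X in _ + X]big1 ?addr0 // => k ki;
   rewrite big1 // => v _; rewrite F0.
Qed.

(** * Codegrees in hypergraphs *)

(** Such a set is [A] together with an arbitrary subset of [B :\: A]. *)
Lemma card_sets_between (T : finType) (A B : {set T}) (k : nat) :
  A \subset B -> (#|A| <= k)%N ->
  #|[set e : {set T} | [&& #|e| == k, A \subset e & e \subset B]]|
  = 'C(#|B| - #|A|, k - #|A|).
Proof.
move=> AB Ak; have -> : (#|B| - #|A|)%N = #|B :\: A|.
  by rewrite cardsD (setIidPr AB).
rewrite -cards_draws -[RHS](@card_in_imset _ _ (setU A)); last first.
  move=> e f; rewrite !inE !subsetD.
  move=> /andP[/andP[_ eA] _] /andP[/andP[_ fA] _].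
  move=> /(congr1 (fun B => B :\: A)); rewrite !setDUl !setDv !set0U.
  by rewrite (setDidPl eA) (setDidPl fA).
apply: eq_card => e; rewrite !inE; apply/idP/imsetP.
  case/and3P=> /eqP ek Ae eB; exists (e :\: A); last first.
    by rewrite -[LHS](setID e A) (setIidPr Ae).
  by rewrite inE setSD //= cardsD (setIidPr Ae) ek.
case=> f; rewrite inE subsetD => /andP[/andP[fB fA] /eqP fk] ->.
rewrite cardsU (setIC A) (disjoint_setI0 fA) cards0 subn0 fk subnKC // eqxx.
by rewrite subsetUl subUset AB fB.
Qed.

Definition codegree (T : finType) (H : hypergraph T) (u v : T) : nat :=
  #|[set e in H | (u \in e) && (v \in e)]|.

(** Double count the pairs of an edge through [u] and another vertex of it:
    each of the [r] edges through [u] has [m - 1] other vertices. *)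
Lemma sum_codegree (T : finType) (H : hypergraph T) (m r : nat) (u : T) :
  uniform m H -> regular r H ->
  (\sum_(v | u != v) codegree H u v = r * m.-1)%N.
Proof.
move=> Hm Hr; rewrite -(Hr u) -sum_nat_const.
under eq_bigr do rewrite /codegree -sum1_card big_mkcond.
rewrite exchange_big [RHS]big_mkcond; apply: eq_bigr => e _.
rewrite inE; have [eH|] := boolP (e \in H); last first.
  by move=> eH; rewrite big1 // => v _; rewrite inE (negPf eH).
have [ue|ue] := boolP (u \in e); last first.
  by rewrite big1 // => v _; rewrite inE (negPf ue) /= andbF.
rewrite -(Hm e eH) (cardsD1 u e) ue /= -sum1_card.
rewrite [RHS]big_mkcond [LHS]big_mkcond.
by apply: eq_bigr => v _; rewrite !inE eH ue (eq_sym u); case: eqP.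
Qed.

(** * Codegrees in the corona *)

Section CoronaCodegree.
Variables (n : nat) (V : 'I_n -> finType) (m n1 : nat).
Variables (H0 : hypergraph 'I_n) (H : forall i, hypergraph (V i)).
Hypothesis hm : (2 <= m)%N.
Hypothesis hV : forall i, #|V i| = n1.

(** Each edge of the corona that does not come from the base hypergraph lies
    in a cone. *)
Definition cone (k : 'I_n) : {set corona_vertex V} :=
  base V k |: [set copy v | v : V k].

Lemma base_inj : injective (base V).
Proof. by move=> i j []. Qed.

Lemma copy_inj (i : 'I_n) : injective (@copy n V i).
Proof. by move=> u v uv; apply: eq_from_Tagged (inr_inj uv). Qed.

Lemma copyN_base (i j : 'I_n) (v : V j) : (copy v == base V i) = false.
Proof. by []. Qed.

(** [e] is a [mem_pred] so that the lemma applies to images of sets and of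
    whole types alike. *)
Lemma base_in_copies (i j : 'I_n) (e : mem_pred (V j)) :
  (base V i \in imset (@copy n V j) e) = false.
Proof. by apply/negP => /imsetP[]. Qed.

Lemma copy_in_bases (i : 'I_n) (v : V i) (e : {set 'I_n}) :
  (copy v \in [set base V j | j in e]) = false.
Proof. by apply/negP => /imsetP[]. Qed.

Lemma base_in_cone (i k : 'I_n) : (base V i \in cone k) = (i == k).
Proof. by rewrite in_setU1 base_in_copies orbF (inj_eq base_inj). Qed.

Lemma copy_in_cone (i k : 'I_n) (v : V i) : (copy v \in cone k) = (i == k).
Proof.
rewrite in_setU1 copyN_base; apply/imsetP/eqP => [[w _ vw]|ik].
  exact: (congr1 tag (inr_inj vw)).
by subst k; exists v.
Qed.

Lemma card_cone (k : 'I_n) : #|cone k| = n1.+1.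
Proof.
by rewrite cardsU1 base_in_copies (card_imset _ (@copy_inj k)) hV.
Qed.

Lemma copies_sub_cone (k : 'I_n) (e : {set V k}) :
  [set copy v | v in e] \subset cone k.
Proof. by apply/subsetP => _ /imsetP[v _ ->]; rewrite copy_in_cone. Qed.

Lemma join_sub_cone (k : 'I_n) (e : {set corona_vertex V}) :
  e \in join_edges V m k -> e \subset cone k.
Proof. by rewrite inE => /and4P[]. Qed.

(** As [m >= 2], an edge through the apex of the cone automatically meets the
    copy below it. *)
Lemma mem_join_edges (k : 'I_n) (e : {set corona_vertex V}) :
  (e \in join_edges V m k)
  = [&& #|e| == m, base V k \in e & e \subset cone k].
Proof.
rewrite inE /cone; case: eqP => //= em; rewrite andbC -andbA.
have [ke|] //= := boolP (base V k \in e).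
have [es|] := boolP (e \subset _); rewrite ?andbT ?andbF //.
have : (0 < #|e :\ base V k|)%N.
  by move: hm; rewrite -em (cardsD1 (base V k) e) ke.
case/card_gt0P => x; rewrite !inE => /andP[xk xe]; apply/existsP.
move/(subsetP es): (xe); rewrite in_setU1 (negPf xk) => /imsetP[v _ xv].
by exists v; rewrite -xv.
Qed.

Lemma coronaP (e : {set corona_vertex V}) :
  reflect [\/ exists2 f, f \in H0 & e = [set base V i | i in f],
              exists i, exists2 f, f \in H i & e = [set copy v | v in f]
            | exists i, e \in join_edges V m i]
          (e \in corona m H0 H).
Proof.
rewrite !in_setU -orbA; apply: (iffP or3P).
  case=> [/imsetP[f fH ->]|/bigcupP[i _ /imsetP[f fH ->]]|/bigcupP[i _ ei]].
  - by apply: Or31; exists f.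
  - by apply: Or32; exists i, f.
  - by apply: Or33; exists i.
case=> [[f fH ->]|[i [f fH ->]]|[i ei]].
- by apply: Or31; apply: imset_f.
- by apply: Or32; apply/bigcupP; exists i; rewrite ?imset_f.
- by apply: Or33; apply/bigcupP; exists i.
Qed.

Lemma codegree_base (i j : 'I_n) :
  i != j -> codegree (corona m H0 H) (base V i) (base V j) = codegree H0 i j.
Proof.
move=> ij; rewrite /codegree -(card_imset _ (imset_inj base_inj)).
apply: eq_card => e; apply/setIdP/imsetP => [[/coronaP eH /andP[ie je]]|].
  case: eH => [[f fH ef]|[k [f _ ef]]|[k /join_sub_cone/subsetP ek]].
  - exists f => //; move: ie je; rewrite ef !mem_imset; try exact: base_inj.
    by rewrite inE fH => -> ->.
  - by rewrite ef base_in_copies in ie.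
  - move/ek: ie; move/ek: je; rewrite !base_in_cone => /eqP jk /eqP ik.
    by rewrite ik jk eqxx in ij.
case=> f; rewrite inE => /and3P[fH fi fj] ->; split.
  by apply/coronaP/Or31; exists f.
by rewrite !imset_f.
Qed.

(** For [i = j] the common edges are the [m]-subsets of a cone, which has
    [n1 + 1] points, that contain two prescribed points. *)
Lemma codegree_base_copy (i j : 'I_n) (v : V j) :
  codegree (corona m H0 H) (base V i) (copy v)
  = if i == j then 'C(n1 - 1, m - 2) else 0%N.
Proof.
have mem_edge e : e \in corona m H0 H -> base V i \in e -> copy v \in e ->
    i = j /\ e \in join_edges V m i.
  move=> /coronaP[[f _ ->]|[k [f _ ->]]|[k ek]].
  - by rewrite copy_in_bases.
  - by rewrite base_in_copies.
  have /subsetP sk := join_sub_cone ek.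
  move=> /sk; rewrite base_in_cone => /eqP -> /sk.
  by rewrite copy_in_cone => /eqP ->.
case: eqVneq => [ij|ij]; last first.
  apply/eqP; rewrite cards_eq0; apply/eqP/setP => e; rewrite inE [RHS]inE.
  apply/negP => /and3P[eH ie ve].
  by case: (mem_edge e eH ie ve) => /eqP; rewrite (negPf ij).
subst j; have card2 : #|[set base V i; copy v]| = 2%N by rewrite cards2.
rewrite -[(n1 - 1)%N]subSS -(card_cone i) -card2 -card_sets_between;
  last 2 first.
- by rewrite subUset !sub1set base_in_cone copy_in_cone eqxx.
- by rewrite card2.
apply: eq_card => e; rewrite [RHS]inE subUset !sub1set; apply/setIdP/idP.
  case=> eH /andP[ie ve]; have [_] := mem_edge e eH ie ve.
  by rewrite mem_join_edges ve => /and3P[-> -> ->].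
case/and3P=> em /andP[ie ve] es; rewrite ie ve; split=> //.
by apply/coronaP/Or33; exists i; rewrite mem_join_edges em ie es.
Qed.

Lemma codegree_copies (i j : 'I_n) (u : V i) (v : V j) :
  i != j -> codegree (corona m H0 H) (copy u) (copy v) = 0%N.
Proof.
move=> ij; apply/eqP; rewrite cards_eq0; apply/eqP/setP => e.
rewrite inE [RHS]inE; apply/negP => /andP[/coronaP eH /andP[ue ve]].
have [k /subsetP sk] : exists k, e \subset cone k.
  case: eH => [[f _ ef]|[k [f _ ->]]|[k /join_sub_cone ek]].
  - by rewrite ef copy_in_bases in ue.
  - by exists k; apply: copies_sub_cone.
  - by exists k.
move/sk: ue; move/sk: ve; rewrite !copy_in_cone => /eqP jk /eqP ik.
by rewrite ik jk eqxx in ij.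
Qed.

(** The edges through two vertices of one copy are those of the copy and the
    [m]-subsets of the cone containing both vertices and the apex. There are
    ['C(n1 - 2, m - 3)] of the latter if [m >= 3], which is the difference
    below by Pascal's rule, and none if [m = 2], when that difference is
    [1 - 1]. *)
Lemma codegree_copy (i : 'I_n) (u v : V i) :
  u != v -> (codegree (corona m H0 H) (copy u) (copy v)
  = codegree (H i) u v + ('C(n1 - 1, m - 2) - 'C(n1 - 2, m - 2)))%N.
Proof.
move=> uv; pose A := [set base V i; copy u; copy v].
have cardA : #|A| = 3%N.
  by rewrite /A -setUA cardsU1 cards2 !inE /= (inj_eq (@copy_inj i)) uv.
have n1_gt1 : (1 < n1)%N.
  by have := max_card [set u; v]; rewrite cards2 uv hV.
have -> : ('C(n1 - 1, m - 2) - 'C(n1 - 2, m - 2))%N =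
    #|[set e : {set corona_vertex V} |
        [&& #|e| == m, A \subset e & e \subset cone i]]|.
  case: (ltnP 2 m) => m2.
    rewrite card_sets_between; last 2 first.
    - by rewrite !subUset !sub1set base_in_cone !copy_in_cone eqxx.
    - by rewrite cardA.
    rewrite cardA card_cone; have [[k ->] [l ->]] : (exists k, m = k.+3) /\
        (exists l, n1 = l.+2).
      by split; [exists (m - 3)%N|exists (n1 - 2)%N]; lia.
    by rewrite !subSS !subn0 binS addKn.
  have -> : m = 2%N by apply/eqP; rewrite eqn_leq m2.
  rewrite !bin0 subnn; apply/esym/eqP; rewrite cards_eq0; apply/eqP/setP => e.
  rewrite inE [RHS]inE; apply/negP => /and3P[/eqP e2 /subset_leq_card].
  by rewrite cardA e2.
rewrite /codegree -(card_imset _ (imset_inj (@copy_inj i))) -cardsUI.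
rewrite [X in (_ = _ + X)%N](_ : _ = 0%N) ?addn0; last first.
  apply/eqP; rewrite cards_eq0; apply/eqP/setP => e; rewrite inE [RHS]inE.
  apply/negP => /andP[/imsetP[f _ ->]]; rewrite inE !subUset !sub1set.
  by rewrite base_in_copies andbF.
apply: eq_card => e; rewrite in_setU; apply/setIdP/orP.
  case=> /coronaP eH /andP[ue ve].
  case: eH => [[f _ ef]|[k [f fH ef]]|[k ek]].
  - by rewrite ef copy_in_bases in ue.
  - left; have ik : i = k.
      apply/eqP; rewrite -(copy_in_cone k u).
      by apply: (subsetP (copies_sub_cone f)); rewrite -ef.
    subst k; rewrite ef imset_f // inE fH.
    by move: ue ve; rewrite ef !mem_imset; try exact: copy_inj; move=> -> ->.
  - right; have ik : i = k.
      apply/eqP; rewrite -(copy_in_cone k u).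
      by apply: (subsetP (join_sub_cone ek)).
    subst k; move: ek; rewrite mem_join_edges inE !subUset !sub1set ue ve.
    by case/and3P=> -> -> ->.
case=> [/imsetP[f]|].
  rewrite inE => /and3P[fH uf vf] ->; rewrite !imset_f //; split=> //.
  by apply/coronaP/Or32; exists i, f.
rewrite inE !subUset !sub1set => /and3P[em /andP[/andP[ie ue] ve] es].
rewrite ue ve; split=> //.
by apply/coronaP/Or33; exists i; rewrite mem_join_edges em ie es.
Qed.

End CoronaCodegree.

(** * Adjacency weights *)

Definition weight (R : fieldType) (m : nat) (T : finType) (H : hypergraph T)
    (u v : T) : R :=
  if u == v then 0 else (codegree H u v)%:R / m.-1%:R.

Lemma weightC (R : fieldType) (m : nat) (T : finType) (H : hypergraph T) :
  commutative (weight R m H).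
Proof.
move=> u v; rewrite /weight eq_sym; case: eqP => // _; congr (_%:R / _).
by apply: eq_card => e; rewrite !inE [_ && (v \in e)]andbC.
Qed.

Lemma horner_char_poly_adjacency (R : fieldType) (m : nat) (T : finType)
    (H : hypergraph T) (x : R) :
  (char_poly (adjacency R m H)).[x]
  = fdet (fun u v => x *+ (u == v) - weight R m H u v).
Proof.
rewrite horner_char_poly; congr (\det _); apply/matrixP => i j.
by rewrite !mxE (inj_eq enum_val_inj) /weight (inj_eq enum_val_inj).
Qed.

Lemma sum_weight (R : numFieldType) (m r : nat) (T : finType)
    (H : hypergraph T) (u : T) :
  (2 <= m)%N -> uniform m H -> regular r H -> \sum_v weight R m H u v = r%:R.
Proof.
move=> hm Hm Hr; have m0 : m.-1%:R != 0 :> R by rewrite pnatr_eq0; lia.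
transitivity (\sum_(v | u != v) (codegree H u v)%:R / m.-1%:R : R).
  by rewrite [RHS]big_mkcond; apply: eq_bigr => v _; rewrite /weight; case: eqP.
by rewrite -mulr_suml -natr_sum (sum_codegree u Hm Hr) natrM mulfK.
Qed.

Lemma binz_sub (N k l : nat) :
  (k <= N)%N -> binz (N%:Z - k%:Z) l = 'C(N - k, l).
Proof. by move=> kN; rewrite subzn. Qed.

Section CoronaWeight.
Variables (R : rcfType) (n : nat) (V : 'I_n -> finType) (m n1 : nat).
Variables (H0 : hypergraph 'I_n) (H : forall i, hypergraph (V i)).
Hypotheses (hm : (2 <= m)%N) (hn1 : (0 < n1)%N).
Hypothesis hV : forall i, #|V i| = n1.

Let w := weight R m (corona m H0 H).

Lemma weight_base (i j : 'I_n) : w (base V i) (base V j) = weight R m H0 i j.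
Proof.
rewrite /w /weight (inj_eq (@base_inj n V)).
by have [//|ij] := eqVneq i j; rewrite codegree_base.
Qed.

Lemma weight_base_copy (i j : 'I_n) (v : V j) :
  w (base V i) (copy v) = if i == j then corona_b R m n1 else 0.
Proof.
rewrite /w /weight /= (codegree_base_copy _ _ hm hV) /corona_b.
by case: eqP; rewrite ?mul0r // (binz_sub _ hn1).
Qed.

Lemma weight_copies (i j : 'I_n) (u : V i) (v : V j) :
  i != j -> w (copy u) (copy v) = 0.
Proof.
by move=> ij; rewrite /w /weight codegree_copies // mul0r; case: ifP.
Qed.

(** For [u != v] the copy has at least two vertices, so the upper index
    [n1 - 2] in [corona_c] is not negative. *)
Lemma weight_copy (i : 'I_n) (u v : V i) :
  w (copy u) (copy v) = weight R m (H i) u v + corona_c R m n1 *+ (u != v).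
Proof.
rewrite /w /weight (inj_eq (@copy_inj n V i)).
have [_|uv] := eqVneq u v; first by rewrite addr0.
have n1_gt1 : (1 < n1)%N by have := max_card [set u; v]; rewrite cards2 uv hV.
rewrite (codegree_copy _ _ hm hV uv) natrD mulrDl /corona_c.
rewrite (binz_sub _ n1_gt1) (binz_sub _ (ltnW n1_gt1)) natrB //.
by apply/leq_bin2l/leq_sub2l.
Qed.

End CoronaWeight.

(** * The spectrum of the corona *)

(** [corona_alpha] gives the roots of the characteristic polynomial of the
    two by two quotient matrix with rows [(mu, b n1)] and [(b, t)], where
    [t] is the row sum inside a copy. *)
Lemma corona_alphaP (R : rcfType) (m n1 r1 : nat) (mu x : R) :
  (x - corona_alpha m n1 r1 mu false) * (x - corona_alpha m n1 r1 mu true)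
  = (x - mu) * (x - (r1%:R + (n1%:R - 1) * corona_c R m n1))
    - corona_b R m n1 ^+ 2 * n1%:R.
Proof.
rewrite /corona_alpha; set b := corona_b R m n1.
set t := _ + _ * corona_c R m n1.
set D := (t - mu) ^+ 2 + 4 * b ^+ 2 * n1%:R.
have D0 : 0 <= D.
  by rewrite addr_ge0 ?sqr_ge0 // mulr_ge0 ?ler0n // mulr_ge0 ?sqr_ge0 ?ler0n.
have := sqr_sqrtr D0; rewrite {2}/D expr0 expr1; move: (Num.sqrt D) => s sD.
have -> : b ^+ 2 * n1%:R = (s ^+ 2 - (t - mu) ^+ 2) / 4 by rewrite sD; field.
by field.
Qed.

Theorem corollary4p1p1 (R : rcfType) (m n n1 r1 : nat)
    (V : 'I_n -> finType)
    (H0 : hypergraph 'I_n) (H : forall i : 'I_n, hypergraph (V i))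
    (mu : 'I_n -> R) (lambda : 'I_n -> 'I_n1 -> R)
    (hm : (2 <= m)%N) (hn1 : (0 < n1)%N)
    (hV : forall i : 'I_n, #|V i| = n1)
    (hH0 : uniform m H0)
    (hH : forall i : 'I_n, uniform m (H i))
    (hr1 : forall i : 'I_n, regular r1 (H i))
    (hmu : is_spectrum (adjacency R m H0) [seq mu i | i <- enum 'I_n])
    (hlambda : forall i : 'I_n,
       is_spectrum (adjacency R m (H i)) [seq lambda i j | j <- enum 'I_n1])
    (hlast : forall (i : 'I_n) (j : 'I_n1), j.+1 = n1 -> lambda i j = r1%:R) :
  is_spectrum (adjacency R m (corona m H0 H))
    ([seq lambda i j - corona_c R m n1 |
        i <- enum 'I_n, j <- [seq j : 'I_n1 <- enum 'I_n1 | (j.+1 < n1)%N]]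
     ++ [seq corona_alpha m n1 r1 (mu i) false | i <- enum 'I_n]
     ++ [seq corona_alpha m n1 r1 (mu i) true | i <- enum 'I_n]).
Proof.
set b := corona_b R m n1; set c := corona_c R m n1.
set t := r1%:R + (n1%:R - 1) * c.
apply: (@poly_eq_outside _ [:: t; r1%:R - c]) => x.
rewrite !inE !negb_or => /andP[xt xr].
have {xt} xt0 : x - t != 0 by rewrite subr_eq0.
have {xr} xr0 : x + c - r1%:R != 0.
  by apply: contraNneq xr => xr; apply/eqP; rewrite -[LHS]subr0 -xr; ring.
(* The corona adds [c] off the diagonal of a copy: that is, the constant
   matrix [c] is added and [c] is removed on the diagonal, which shifts [x]. *)
pose f i u v := (x + c) *+ (u == v) - weight R m (H i) u v.
pose F (p q : corona_vertex V) :=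
  x *+ (p == q) - weight R m (corona m H0 H) p q.
have Fcopy i (u v : V i) : F (copy u) (copy v) = f i u v - c.
  rewrite /F (weight_copy _ _ _ hm hV) (inj_eq (@copy_inj n V i)) -/c /f.
  by case: eqP => _ /=; rewrite !(mulr1n, mulr0n); ring.
have Fcopies i j (u : V i) (v : V j) : i != j -> F (copy u) (copy v) = 0.
  move=> ij; rewrite /F weight_copies // subr0.
  suff -> : (copy u == copy v) = false by [].
  by apply: contra_neqF ij => /eqP uv; exact: (congr1 tag (inr_inj uv)).
have sumf i u : \sum_v f i u v = x + c - r1%:R.
  rewrite sumrB (sum_weight _ _ hm (hH i) (hr1 i)); congr (_ - _).
  rewrite (bigD1 u) //= eqxx big1 ?addr0 // => v.
  by rewrite eq_sym => /negPf ->.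
have sumF i (u : V i) : \sum_(v : V i) F (copy u) (copy v) = x - t.
  under eq_bigr do rewrite Fcopy.
  by rewrite sumrB sumf sumr_const hV -mulr_natl /t; ring.
rewrite horner_char_poly_adjacency -/F.
(* Inside a copy the rows of the kernel sum to [x - t], so the indicator of
   each copy is an eigenvector; dividing by [x - t] solves the system. *)
pose U (q : {i : 'I_n & V i}) (i : 'I_n) :=
  if tag q == i then - b / (x - t) else 0.
rewrite (@fdet_sum_schur _ _ _ _ U); last first.
  case=> i u j; rewrite (@sum_tagged _ _ _ _ j) => [|q qj]; last first.
    by rewrite /U (negPf qj) mulr0.
  rewrite /F weightC (weight_base_copy _ _ _ hm hn1 hV) -/b.
  rewrite /U /= eqxx -mulr_suml.
  have [->|ij] := eqVneq j i; last first.
    by rewrite big1 ?mul0r ?subrr // => v _; apply: Fcopies; rewrite eq_sym.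
  by rewrite [X in X * _]sumF sub0r mulrC divfK.
rewrite fdet_tagged => [|[i u] [j v] /= ij]; last exact: Fcopies.
have -> : fdet (fun i j => F (base V i) (base V j)
                    - \sum_q F (base V i) (inr q) * U q j)
    = \prod_i (x - b ^+ 2 * n1%:R / (x - t) - mu i).
  transitivity (char_poly (adjacency R m H0)).[x - b ^+ 2 * n1%:R / (x - t)].
    rewrite horner_char_poly_adjacency; apply: eq_fdet => i j.
    rewrite (@sum_tagged _ _ _ _ j) => [|q qj]; last first.
      by rewrite /U (negPf qj) mulr0.
    under eq_bigr => v _.
      rewrite /U eqxx /F (weight_base_copy _ _ _ hm hn1 hV) sub0r -/b; over.
    rewrite sumr_const hV /F weight_base (inj_eq (@base_inj n V)).
    by case: eqP => _; rewrite ?mulr1n ?mulr0n -mulr_natl; field.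
  rewrite hmu horner_prod big_map big_enum.
  by apply: eq_bigr => i _; rewrite hornerXsubC.
have block i : fdet (fun u v : V i => F (copy u) (copy v))
    = \prod_(j < n1 | (j.+1 < n1)%N) (x - (lambda i j - c)) * (x - t).
  transitivity (fdet (fun u v => f i u v - c)); first exact: eq_fdet (Fcopy i).
  rewrite (fdet_sub_const _ xr0 (sumf i)) -horner_char_poly_adjacency hlambda.
  rewrite horner_prod big_map big_enum hV /=.
  (* The eigenvalue [r1] of the all-ones vector is the one that is removed:
     its factor cancels the denominator of the rank-one update. *)
  have last_ltn : (n1.-1 < n1)%N by rewrite prednK.
  rewrite (bigD1 (Ordinal last_ltn)) //= hornerXsubC hlast /= ?prednK //.
  have -> : x + c - r1%:R - n1%:R * c = x - t by rewrite /t; ring.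
  rewrite mulrAC mulrA mulrC; congr (_ * _); last by field.
  apply: eq_big => j; last by rewrite hornerXsubC => _; ring.
  rewrite -val_eqE /=; have := ltn_ord j; lia.
under [X in _ * X]eq_bigr => i _ do rewrite block.
rewrite horner_prod !big_cat big_allpairs_dep !big_map -!enumT !big_enum /=.
(* One factor [x - t] per copy turns [x - b ^+ 2 n1 / (x - t) - mu i] into
   the quadratic polynomial with roots [corona_alpha]. *)
rewrite big_split /= mulrC -[LHS]mulrA; congr (_ * _).
  apply: eq_big => // i _; rewrite big_filter big_enum_cond /=.
  by apply: eq_big => // j _; rewrite hornerXsubC.
rewrite -!big_split /=; apply: eq_big => // i _.
by rewrite !hornerXsubC corona_alphaP -/t -/b; field.
Qed.
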